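(* Let $\mathcal{S}=\{p_1,\dots,p_n\}\subset\mathbb{R}^d/\mathbb{R}\mathbf{1}$ and let $f_{\mathcal{S}}(x)=\sum_{i=1}^n d_{\mathrm{tr}}(x,p_i)$. Then $\mathrm{FW}(\mathcal{S})$, the set of minimizers of $f_{\mathcal{S}}$, is defined by a unique, maximal cell $C$ of $\mathrm{BCD}(\mathcal{S})$ such that $\mathbf{0}\in\partial f_{\mathcal{S}}(x)$ for all $x\in C$.
   Context: $\mathbb{R}^d/\mathbb{R}\mathbf{1}$ is the quotient of $\mathbb{R}^d$ by the line spanned by $\mathbf{1}=(1,\dots,1)$, identified with $\mathbb{R}^{d-1}$. The tropical metric is $d_{\mathrm{tr}}(u,v)=\max_{j\in[d]}(u_j-v_j)-\min_{k\in[d]}(u_k-v_k)$. $\partial f_{\mathcal{S}}(x_0)$ denotes the subdifferential of $f_{\mathcal{S}}$ at $x_0$: the set of vectors $g$ with $f_{\mathcal{S}}(x)\ge f_{\mathcal{S}}(x_0)+\langle g,x-x_0\rangle$ for all $x$. Let $V$ be the $n\times d$ matrix with rows $v_i=p_i$. For $x$ define $G_V(x)=\{(i,j): j\in\arg\max_k(x_k-v_{ik})\}$ and $\overline{G}_V(x)=\{(j,i): j\in\arg\min_k(x_k-v_{ik})\}$. The bi-tropical covector decomposition $\mathrm{BCD}(\mathcal{S})$ is the polyhedral subdivision of $\mathbb{R}^d/\mathbb{R}\mathbf{1}$ induced by the union of the max-plus and min-plus tropical hyperplanes with apices $p_1,\dots,p_n$; its closed cells are the sets $C(x)=\{y: G_V(y)\supseteq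 G_V(x),\ \overline{G}_V(y)\supseteq \overline{G}_V(x)\}$, i.e. $\{y: y_j-y_k\ge v_{ij}-v_{ik}\ \forall (i,j)\in G_V(x),k;\ y_j-y_k\le v_{ij}-v_{ik}\ \forall (j,i)\in\overline{G}_V(x),k\}$. *)

(* Defs.v *)
From mathcomp Require Import all_boot all_order all_algebra.
From mathcomp Require Import classical_sets reals.

Set Implicit Arguments.
Unset Strict Implicit.
Unset Printing Implicit Defensive.

Import Order.TTheory GRing.Theory Num.Theory.
Local Open Scope classical_set_scope.
Local Open Scope ring_scope.
Local Open Scope quotient_scope.

(* Coordinates are indexed by 'I_d.+1, so that maxima and minima range over a
   nonempty set: the ambient space is R^(d+1)/R1, and d here is the usual d - 1. *)

Definition ones_line (R : realType) (d : nat) : {vspace 'rV[R]_d.+1} :=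
  <[const_mx 1]>%VS.

Definition tropical_torus (R : realType) (d : nat) : Type :=
  Quotient.quot (ones_line R d).

Section TropicalTorus.
Variables (R : realType) (d : nat).
Local Notation torus := (tropical_torus R d).
Implicit Types (g u v : 'rV[R]_d.+1) (x y : torus).

Definition max_coord u : R := \big[Num.max/u 0 ord0]_j u 0 j.
Definition min_coord u : R := \big[Num.min/u 0 ord0]_j u 0 j.

(* The functions on the torus below are computed on the representatives chosen
   by [repr]; the lemmas ending this file show that the choice is irrelevant. *)
Definition dtr x y : R :=
  max_coord (repr x - repr y) - min_coord (repr x - repr y).

Definition pairing g u : R := \sum_j g 0 j * u 0 j.

(* Linear forms on R^(d+1)/R1 are the vectors g with zero coordinate sum, i.e.
   those orthogonal to 1. *)
Definition subdifferential (f : torus -> R) (x0 : torus) : set 'rV[R]_d.+1 :=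
  [set g : 'rV[R]_d.+1 | \sum_j g 0 j = 0 /\
           forall x, f x0 + pairing g (repr x - repr x0) <= f x].

Section Points.
Variables (n : nat).

Definition max_covector (V : 'M[R]_(n, d.+1)) u : {set 'I_n * 'I_d.+1} :=
  [set ij | [forall k, u 0 k - V ij.1 k <= u 0 ij.2 - V ij.1 ij.2]]%SET.

Definition min_covector (V : 'M[R]_(n, d.+1)) u : {set 'I_d.+1 * 'I_n} :=
  [set ji | [forall k, u 0 ji.1 - V ji.2 ji.1 <= u 0 k - V ji.2 k]]%SET.

Variable p : 'I_n -> torus.

Definition point_matrix : 'M[R]_(n, d.+1) := \matrix_i repr (p i).

Definition sum_dtr x : R := \sum_i dtr x (p i).

Definition FW : set torus := [set x | forall y, sum_dtr x <= sum_dtr y].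

Definition cell x : set torus :=
  [set y |
    (max_covector point_matrix (repr x)
       \subset max_covector point_matrix (repr y)) /\
    (min_covector point_matrix (repr x)
       \subset min_covector point_matrix (repr y))].

Definition BCD : set (set torus) := range cell.

Definition stationary_cell (C : set torus) : Prop :=
  BCD C /\ forall x, C x -> subdifferential sum_dtr x 0.

Definition maximal_stationary_cell (C : set torus) : Prop :=
  stationary_cell C /\ forall D, stationary_cell D -> C `<=` D -> D = C.

End Points.

Lemma eq_torusP u v :
  reflect (exists c, u = v + const_mx c) (\pi_torus u == \pi_torus v).
Proof.
rewrite -Quotient.idealrBE; apply: (iffP idP) => [/vlineP[c Ec]|[c ->]].
  exists c; apply/eqP; rewrite addrC -subr_eq; apply/eqP; rewrite Ec.
  by apply/rowP => j; rewrite !mxE mulr1.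
apply/vlineP; exists c.
by apply/rowP => j; rewrite !mxE mulr1 addrC addKr.
Qed.

Lemma repr_pi u : exists c, repr (\pi_torus u) = u + const_mx c.
Proof. by apply/eq_torusP; rewrite reprK. Qed.

Lemma max_coordD u c : max_coord (u + const_mx c) = max_coord u + c.
Proof.
rewrite /max_coord !mxE.
elim/big_rec2: _ => // j a b _ ->.
by rewrite !mxE addr_maxl.
Qed.

Lemma min_coordD u c : min_coord (u + const_mx c) = min_coord u + c.
Proof.
rewrite /min_coord !mxE.
elim/big_rec2: _ => // j a b _ ->.
by rewrite !mxE addr_minl.
Qed.

Lemma dtr_pi u v :
  dtr (\pi u) (\pi v) = max_coord (u - v) - min_coord (u - v).
Proof.
rewrite /dtr; have [a ->] := repr_pi u; have [b ->] := repr_pi v.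
have -> : u + const_mx a - (v + const_mx b) = u - v + const_mx (a - b).
  by apply/rowP => j; rewrite !mxE opprD addrACA.
by rewrite max_coordD min_coordD opprD addrACA subrr addr0.
Qed.

Lemma pairing_pi g u v : \sum_j g 0 j = 0 ->
  pairing g (repr (\pi_torus u) - repr (\pi_torus v)) = pairing g (u - v).
Proof.
move=> g0; have [a ->] := repr_pi u; have [b ->] := repr_pi v.
transitivity (pairing g (u - v) + (\sum_j g 0 j) * (a - b)).
  rewrite /pairing mulr_suml -big_split /=; apply: eq_bigr => j _.
  by rewrite !mxE -mulrDr opprD addrACA.
by rewrite g0 mul0r addr0.
Qed.

Section Covectors.
Variables (n : nat) (V W : 'M[R]_(n, d.+1)) (u v : 'rV[R]_d.+1).
Hypothesis VW : forall i, \pi_torus (row i V) = \pi_torus (row i W).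
Hypothesis uv : \pi_torus u = \pi_torus v.

Let shift i : exists c, forall k, u 0 k - V i k = v 0 k - W i k + c.
Proof.
have /eqP/eq_torusP[a Ea] := uv; have /eqP/eq_torusP[b /rowP Eb] := VW i.
exists (a - b) => k; move: (Eb k); rewrite Ea !mxE => ->.
by rewrite opprD addrACA.
Qed.

Lemma max_covector_pi : max_covector V u = max_covector W v.
Proof.
apply/setP => -[i j]; rewrite !inE /=; have [c Ec] := shift i.
by apply: eq_forallb => k; rewrite !Ec lerD2r.
Qed.

Lemma min_covector_pi : min_covector V u = min_covector W v.
Proof.
apply/setP => -[j i]; rewrite !inE /=; have [c Ec] := shift i.
by apply: eq_forallb => k; rewrite !Ec lerD2r.
Qed.

End Covectors.

End TropicalTorus.

(* Main.v *)
(** The function f is a sum of convex terms, so at the midpoint of two of its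
    minimizers every maximum and minimum occurring in f is additive; hence the
    covectors of the midpoint lie in those of both endpoints.  A minimizer x
    with as few covectors as possible therefore has FW inside its cell.
    Conversely f is affine on the cell of x and x is in the relative interior,
    so f is constant there.  Finally 0 is a subgradient exactly at the
    minimizers, so every stationary cell is contained in FW. *)
Require Import Defs.
From mathcomp Require Import all_boot all_order all_algebra.
From mathcomp Require Import classical_sets reals.
From mathcomp Require Import boolp topology normedtype derive ring lra.

Set Implicit Arguments.
Unset Strict Implicit.
Unset Printing Implicit Defensive.

Import Order.TTheory GRing.Theory Num.Theory.
Import numFieldNormedType.Exports.
Local Open Scope classical_set_scope.
Local Open Scope ring_scope.
Local Open Scope quotient_scope.

(** * The maximum coordinate and the tropical seminorm *)

Section Spread.
Variables (R : realType) (d : nat).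
Implicit Types (u v w : 'rV[R]_d.+1) (j k : 'I_d.+1).

Lemma le_max_coord u j : u 0 j <= max_coord u.
Proof. exact: le_bigmax. Qed.

Lemma max_coord_argmax u : exists j, max_coord u = u 0 j.
Proof.
rewrite /max_coord; elim/big_ind: _ => [|x y [j ->] [k ->]|j _].
- by exists ord0.
- by rewrite /Num.max; case: ifP => _; [exists k | exists j].
- by exists j.
Qed.

Lemma max_coord_eq u j :
  (max_coord u == u 0 j) = [forall k, u 0 k <= u 0 j].
Proof.
apply/eqP/forallP => [<- k|uj]; first exact: le_max_coord.
apply/le_anti; rewrite le_max_coord andbT.
by have [k ->] := max_coord_argmax u.
Qed.

Lemma max_coord_midpoint u v :
  max_coord (2^-1 *: (u + v)) <= 2^-1 * (max_coord u + max_coord v).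
Proof.
have [j ->] := max_coord_argmax (2^-1 *: (u + v)); rewrite !mxE.
by rewrite ler_pM2l ?invr_gt0// lerD// le_max_coord.
Qed.

Lemma min_coordE u : min_coord u = - max_coord (- u).
Proof.
rewrite /min_coord /max_coord; elim/big_rec2: _ => [|j x y _ ->].
  by rewrite mxE opprK.
by rewrite mxE oppr_max opprK.
Qed.

(** The tropical seminorm, with its minimum rewritten as a maximum of [- u], so that facts about
    [max_coord] serve both halves. *)
Definition spread u : R := max_coord u + max_coord (- u).

Lemma spreadD_const u c : spread (u + const_mx c) = spread u.
Proof.
rewrite /spread max_coordD (_ : - _ = - u + const_mx (- c)).
  by rewrite max_coordD; ring.
by apply/rowP => j; rewrite !mxE opprD.
Qed.

Lemma spread_ge0 u : 0 <= spread u.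
Proof.
have := lerD (le_max_coord u ord0) (le_max_coord (- u) ord0).
by rewrite !mxE subrr.
Qed.

Lemma spread_midpoint u v :
  spread (2^-1 *: (u + v)) <= 2^-1 * (spread u + spread v).
Proof.
rewrite /spread -scalerN opprD.
have := max_coord_midpoint u v; have := max_coord_midpoint (- u) (- v).
by lra.
Qed.

Lemma ler_norm_spread u j k : `|u 0 j - u 0 k| <= spread u.
Proof.
have := le_max_coord u j; have := le_max_coord (- u) j.
have := le_max_coord u k; have := le_max_coord (- u) k.
by rewrite !mxE /spread ler_norml => *; apply/andP; split; lra.
Qed.

Lemma continuous_max_coord : continuous (@max_coord R d).
Proof.
rewrite /max_coord; elim: (index_enum _) => [|j r IHr] u.
  (* The empty list leaves the default value [u 0 ord0], itself a coordinate of [u]. *)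
  under eq_fun do rewrite big_nil.
  exact: coord_continuous.
under eq_fun do rewrite big_cons.
by apply: continuous_max; [exact: coord_continuous | exact: IHr].
Qed.

Lemma continuous_spread : continuous spread.
Proof.
move=> u; apply: continuousD; first exact: continuous_max_coord.
apply: (continuous_comp (f := fun u : 'rV[R]_d.+1 => - u) (g := @max_coord R d)).
  exact: opp_continuous.
exact: continuous_max_coord.
Qed.

(** Neither summand exceeds its own maximum, so an average that attains the averaged maxima attains
    both. *)
Lemma max_coord_midpoint_argmax u v j :
    max_coord (2^-1 *: (u + v)) = 2^-1 * (max_coord u + max_coord v) ->
    max_coord (2^-1 *: (u + v)) = (2^-1 *: (u + v)) 0 j ->
  max_coord u = u 0 j /\ max_coord v = v 0 j.
Proof.
rewrite !mxE => -> E.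
by have := le_max_coord u j; have := le_max_coord v j; split; lra.
Qed.

(** Read [s] as slacks and [r] as their rates of change: a positive slack survives a small step, and
    a zero slack does not move. *)
Lemma small_step (T : finType) (s r : T -> R) :
    (forall t, 0 <= s t) -> (forall t, s t = 0 -> r t = 0) ->
  exists2 e, 0 < e & forall t, 0 <= s t + e * r t.
Proof.
move=> s_ge0 sr0.
(* The 1 in the denominator avoids division by zero; the default 1 covers the case of no positive
   slack. *)
pose e := \big[Num.min/1]_(t | 0 < s t) (s t / (1 + `|r t|)).
have den_gt0 t : 0 < 1 + `|r t| by rewrite ltr_pwDl.
have e_gt0 : 0 < e by apply/bigmin_gtP; split=> // t st; rewrite divr_gt0.
exists e => // t; have [st|] := ltP 0 (s t); last first.
  move=> st; have st0 : s t = 0 by apply/le_anti; rewrite st s_ge0.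
  by rewrite st0 (sr0 t st0) mulr0 addr0.
have : e <= s t / (1 + `|r t|) by apply: bigmin_le_cond.
rewrite ler_pdivlMr // mulrDr mulr1 => le_e.
have : - (e * r t) <= e * `|r t|.
  by rewrite -mulrN ler_pM2l // -normrN ler_norm.
by lra.
Qed.

(** On the ray from [b t] through [a t], a coordinate maximal at [a t] stays maximal slightly beyond
    it. Finiteness of [T] allows one [e] for the whole family. *)
Lemma extrapolate_argmax (T : finType) (a b : T -> 'rV[R]_d.+1) :
    (forall t j, max_coord (a t) = a t 0 j -> max_coord (b t) = b t 0 j) ->
  exists2 e, 0 < e &
    forall t, max_coord (a t + e *: (a t - b t))
                = max_coord (a t) + e * (max_coord (a t) - max_coord (b t)).
Proof.
move=> ab.
(* After a step [e], the claimed maximum exceeds the coordinate by exactly [s x + e * r x]. *)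
pose s (x : T * 'I_d.+1) := max_coord (a x.1) - a x.1 0 x.2.
pose r (x : T * 'I_d.+1) :=
  (max_coord (a x.1) - max_coord (b x.1)) - (a x.1 0 x.2 - b x.1 0 x.2).
have [x|x /eqP|e e_gt0 He] := @small_step _ s r.
- by rewrite subr_ge0 le_max_coord.
- rewrite subr_eq0 => /eqP sx; rewrite /r (ab _ _ sx) sx subrr //.
exists e => // t; have [j Ej] := max_coord_argmax (a t).
have -> : max_coord (a t) + e * (max_coord (a t) - max_coord (b t))
          = (a t + e *: (a t - b t)) 0 j.
  by rewrite !mxE (ab _ _ Ej) Ej.
apply/eqP; rewrite max_coord_eq; apply/forallP => k.
have := He (t, k); rewrite /s /r !mxE /= (ab _ _ Ej) Ej.
by lra.
Qed.

End Spread.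

(** * The Fermat-Weber objective lifted to vectors *)

Section SpreadSum.
Variables (R : realType) (d n : nat) (V : 'M[R]_(n, d.+1)).
Implicit Types (u v w : 'rV[R]_d.+1) (i : 'I_n) (j k : 'I_d.+1).

Definition spread_sum u : R := \sum_i spread (u - row i V).

Lemma spread_sumD_const u c : spread_sum (u + const_mx c) = spread_sum u.
Proof. by apply: eq_bigr => i _; rewrite addrAC spreadD_const. Qed.

Lemma continuous_spread_sum : continuous spread_sum.
Proof.
rewrite /spread_sum; elim: (index_enum _) => [|i r IHr] u.
  under eq_fun do rewrite big_nil.
  exact: cst_continuous.
under eq_fun do rewrite big_cons.
suff cts_i : {for u, continuous (fun v => spread (v - row i V))}.
  exact: (continuousD cts_i (IHr u)).
apply: (continuous_comp (f := fun u : 'rV[R]_d.+1 => u - row i V)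
  (g := @spread R d)).
  apply: continuousB; last exact: cst_continuous.
  by move=> A; exact: id.
exact: continuous_spread.
Qed.

Definition minimizer u := forall v, spread_sum u <= spread_sum v.

Lemma max_covectorE u i j :
  ((i, j) \in max_covector V u)
    = (max_coord (u - row i V) == (u - row i V) 0 j).
Proof.
rewrite inE max_coord_eq /=; apply: eq_forallb => k.
by rewrite !mxE.
Qed.

Lemma min_covectorE u i j :
  ((j, i) \in min_covector V u)
    = (max_coord (- (u - row i V)) == (- (u - row i V)) 0 j).
Proof.
rewrite inE max_coord_eq /=; apply: eq_forallb => k.
by rewrite !mxE lerN2.
Qed.

Lemma covector_midpoint u v : minimizer u -> minimizer v ->
  let w := 2^-1 *: (u + v) in
  [/\ minimizer w,
      max_covector V w \subset max_covector V u :&: max_covector V v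
    & min_covector V w \subset min_covector V u :&: min_covector V v].
Proof.
move=> umin vmin w.
have Ew i : w - row i V = 2^-1 *: ((u - row i V) + (v - row i V)).
  by apply/rowP => j; rewrite !mxE; field.
have ENw i :
    - (w - row i V) = 2^-1 *: (- (u - row i V) + - (v - row i V)).
  by apply/rowP => j; rewrite !mxE; field.
(* The convexity defect of the i-th term. Each defect is nonnegative, while minimality of [u] and
   [v] makes their sum nonpositive. *)
pose gap i := 2^-1 * (spread (u - row i V) + spread (v - row i V))
                - spread (w - row i V).
have gap_ge0 i : 0 <= gap i by rewrite subr_ge0 Ew spread_midpoint.
have Egap : \sum_i gap i
    = 2^-1 * (spread_sum u + spread_sum v) - spread_sum w.
  by rewrite big_split sumrN -mulr_sumr big_split.
have gap0 i : gap i = 0.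
  apply: (psumr_eq0P (P := predT) (F := gap)) => //.
  apply/le_anti; rewrite sumr_ge0 // andbT Egap.
  by have := umin w; have := vmin w; lra.
have wmin : minimizer w.
  move=> x; have := umin x; have := vmin x; move: Egap.
  by rewrite big1 => [|i _]; [lra | exact: gap0].
(* A zero defect of [spread] is a sum of two nonnegative defects, one per maximum, so both
   vanish. *)
have split_gap i :
    max_coord (w - row i V)
      = 2^-1 * (max_coord (u - row i V) + max_coord (v - row i V)) /\
    max_coord (- (w - row i V))
      = 2^-1 * (max_coord (- (u - row i V)) + max_coord (- (v - row i V))).
  have := gap0 i; rewrite /gap /spread ENw Ew.
  have := max_coord_midpoint (u - row i V) (v - row i V).
  have := max_coord_midpoint (- (u - row i V)) (- (v - row i V)).
  by split; lra.
split=> //; apply/fintype.subsetP.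
  move=> [i j]; rewrite finset.in_setI !max_covectorE => /eqP.
  have [Emax _] := split_gap i; move: Emax; rewrite Ew => Emax Ej.
  by have [-> ->] := max_coord_midpoint_argmax Emax Ej; rewrite !eqxx.
move=> [j i]; rewrite finset.in_setI !min_covectorE => /eqP.
have [_ Emax] := split_gap i; move: Emax.
rewrite ENw => Emax Ej.
by have [-> ->] := max_coord_midpoint_argmax Emax Ej; rewrite !eqxx.
Qed.

(* On the cell of u the function is affine, and u can be moved a little away
   from v without leaving the relative interior of the cell. *)
Lemma minimizer_cell u v : minimizer u ->
    max_covector V u \subset max_covector V v ->
    min_covector V u \subset min_covector V v ->
  minimizer v.
Proof.
move=> umin /fintype.subsetP Gmax /fintype.subsetP Gmin.
(* The boolean selects the maximum or the minimum part of a term, so that a single [e] works for all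
   of them. *)
pose a (x : bool * 'I_n) :=
  if x.1 then u - row x.2 V else - (u - row x.2 V).
pose b (x : bool * 'I_n) :=
  if x.1 then v - row x.2 V else - (v - row x.2 V).
have [[[] i] j|e e_gt0 He] := extrapolate_argmax (a := a) (b := b).
- move=> /eqP; rewrite -max_covectorE => /Gmax.
  by rewrite max_covectorE => /eqP.
- move=> /eqP; rewrite -min_covectorE => /Gmin.
  by rewrite min_covectorE => /eqP.
pose w := u + e *: (u - v).
have Fw : spread_sum w
    = spread_sum u + e * (spread_sum u - spread_sum v).
  rewrite -sumrB mulr_sumr -big_split; apply: eq_bigr => i _ /=.
  have := He (true, i); have := He (false, i); rewrite /a /b /=.
  rewrite /spread (_ : w - row i V
    = u - row i V + e *: (u - row i V - (v - row i V))); last first.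
    by apply/rowP => j; rewrite !mxE; ring.
  rewrite (_ : - (u - row i V) + e *: (- (u - row i V) - - (v - row i V))
    = - (u - row i V + e *: (u - row i V - (v - row i V)))); last first.
    by apply/rowP => j; rewrite !mxE; ring.
  by move=> -> ->; ring.
move=> x; apply: le_trans (umin x).
have := umin w; rewrite Fw lerDl pmulr_rge0 //.
by rewrite subr_ge0.
Qed.

Lemma spread_le_sum u i : spread (u - row i V) <= spread_sum u.
Proof.
rewrite /spread_sum (bigD1 i) //= lerDl sumr_ge0 // => k _.
exact: spread_ge0.
Qed.

(* Normalizing the coordinate 0 of u - row i V to 0 by a multiple of 1 confines
   the points with small value to a box around row i V. *)
Lemma exists_minimizer : exists u, minimizer u.
Proof.
(* Without points the objective is the empty sum and every vector minimizes it. *)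
have [i _|no_i] := pickP (fun _ : 'I_n => true); last first.
  by exists 0 => v; rewrite /spread_sum !big_pred0.
set q := row i V; set M := spread_sum q.
pose box := [set v : 'rV[R]_d.+1 |
              forall j, [set` `[q 0 j - M, q 0 j + M]] (v ord0 j)].
have qbox : box q.
  have M_ge0 : 0 <= M by apply: sumr_ge0 => k _; exact: spread_ge0.
  by move=> j; rewrite /= in_itv /= lerBlDr !lerDl M_ge0.
have cbox : compact box.
  apply: (rV_compact (A := fun j => [set` `[q 0 j - M, q 0 j + M]])) => j.
  exact: segment_compact.
have [|u _ umin] := EVT_min_rV (ex_intro _ q qbox) cbox (f := spread_sum).
  by apply: continuous_subspaceT; exact: continuous_spread_sum.
(* A value above [M] already exceeds the value at [q], which lies in the box. *)
exists u => v; have [vM|/ltW] := leP (spread_sum v) M; last first.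
  by apply: le_trans; apply: umin; rewrite inE.
pose w := v + const_mx (q 0 ord0 - v 0 ord0).
rewrite -(spread_sumD_const v (q 0 ord0 - v 0 ord0)) -/w.
apply: umin; rewrite inE => j; rewrite /= in_itv /= -ler_distlC distrC.
have := ler_norm_spread (w - q) j ord0.
rewrite (_ : (w - q) 0 j - (w - q) 0 ord0 = w ord0 j - q 0 j); last first.
  by rewrite !mxE; ring.
move=> /le_trans; apply; apply: le_trans (spread_le_sum w i) _.
by rewrite spread_sumD_const.
Qed.

Definition covector_size u := (#|max_covector V u| + #|min_covector V u|)%N.

Lemma generic_minimizer : exists2 u, minimizer u &
  forall v, minimizer v -> max_covector V u \subset max_covector V v /\
                           min_covector V u \subset min_covector V v.
Proof.
pose has_size (k : nat) := `[< exists2 u, minimizer u & covector_size u = k >].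
have [|k /asboolP[u umin <-] small] := ex_minnP (P := has_size).
  have [u umin] := exists_minimizer; exists (covector_size u).
  by apply/asboolP; exists u.
exists u => // v vmin; have [] := covector_midpoint umin vmin.
set w := 2^-1 *: (u + v) => wmin; rewrite !finset.subsetI.
move=> /andP[maxu maxv] /andP[minu minv].
have /small : has_size (covector_size w) by apply/asboolP; exists w.
rewrite /covector_size => le_uw.
(* Both covectors of [w] lie in those of [u], yet their total size cannot drop, so both inclusions
   are equalities. *)
have lemax := subset_leq_card maxu; have lemin := subset_leq_card minu.
have /eqP <- : max_covector V w == max_covector V u.
  by rewrite eqEcard maxu -(leq_add2r #|min_covector V u|)
    (leq_trans le_uw) // leq_add2l.
have /eqP <- : min_covector V w == min_covector V u.
  by rewrite eqEcard minu -(leq_add2l #|max_covector V u|)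
    (leq_trans le_uw) // leq_add2r.
by split.
Qed.

End SpreadSum.

(** * Transfer to the tropical torus *)

Section FermatWeber.
Variables (R : realType) (d n : nat) (p : 'I_n -> tropical_torus R d).
Implicit Types (x y : tropical_torus R d) (C : set (tropical_torus R d)).
Local Notation V := (point_matrix p).

Lemma sum_dtr_repr x : sum_dtr p x = spread_sum V (repr x).
Proof.
by apply: eq_bigr => i _; rewrite /dtr /spread rowK min_coordE opprK.
Qed.

Lemma sum_dtr_pi (u : 'rV[R]_d.+1) : sum_dtr p (\pi u) = spread_sum V u.
Proof.
by rewrite sum_dtr_repr; have [c ->] := repr_pi u; rewrite spread_sumD_const.
Qed.

Lemma FW_minimizer x : FW p x <-> minimizer V (repr x).
Proof.
split=> xmin v; first by rewrite -sum_dtr_repr -sum_dtr_pi; exact: xmin.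
by rewrite !sum_dtr_repr; exact: xmin.
Qed.

Lemma FW_subdifferential0 x : FW p x <-> subdifferential (sum_dtr p) x 0.
Proof.
have pairing0 (u : 'rV[R]_d.+1) : pairing 0 u = 0.
  by apply: big1 => j _; rewrite mxE mul0r.
split=> [xmin|[_ xmin] y].
  split=> [|y]; first by apply: big1 => j _; rewrite mxE.
  by rewrite pairing0 addr0.
by have := xmin y; rewrite pairing0 addr0.
Qed.

Lemma FW_cell : BCD p (FW p).
Proof.
have [u umin ucell] := generic_minimizer V.
(* The cell of [\pi u] is computed at a chosen representative, which may differ from [u] by a
   multiple of 1; covectors do not see the difference. *)
have Eu : \pi_(tropical_torus R d) (repr (\pi_(tropical_torus R d) u)) = \pi u.
  exact: reprK.
exists (\pi u) => //; apply/seteqP; split=> y.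
  rewrite /cell /= (max_covector_pi (fun=> erefl) Eu).
  rewrite (min_covector_pi (fun=> erefl) Eu) => -[maxy miny].
  by apply/FW_minimizer; exact: minimizer_cell umin maxy miny.
move=> /FW_minimizer /ucell.
by rewrite /cell /= (max_covector_pi (fun=> erefl) Eu)
  (min_covector_pi (fun=> erefl) Eu).
Qed.

Lemma FW_stationary : stationary_cell p (FW p).
Proof. by split=> [|x /FW_subdifferential0]; [exact: FW_cell|]. Qed.

Lemma stationary_cell_subFW C : stationary_cell p C -> C `<=` FW p.
Proof. by move=> [_ C0] x /C0 /FW_subdifferential0. Qed.

End FermatWeber.

Theorem theorem2 (R : realType) (d n : nat) (p : 'I_n -> tropical_torus R d) :
  exists C : set (tropical_torus R d),
    FW p = C /\ unique (maximal_stationary_cell p) C.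
Proof.
exists (FW p); split=> //; split.
  split=> [|D /stationary_cell_subFW DFW FWD]; first exact: FW_stationary.
  by apply/seteqP.
(* [FW p] is a stationary cell containing [C], so maximality of [C] forces equality. *)
move=> C [/stationary_cell_subFW CFW Cmax].
exact: Cmax (FW_stationary p) CFW.
Qed.
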